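(* The contravariant functor $\Phi$, $X\mapsto\varphi_X$, from the category of 1-dimensional tropical fans to the category of semiring homomorphisms described in the context, is fully faithful. That is, for any 1-dimensional tropical fans $X$ in $\mathbb R^n$ and $Y$ in $\mathbb R^m$, the map $\mu\mapsto\Phi(\mu)$ from the set of morphisms $X\to Y$ to the set of semiring homomorphisms $\mathrm{Im}(\varphi_Y)\to\mathrm{Im}(\varphi_X)$ is bijective.
   Context: Semirings are commutative with $0$ and $1$ ($0$ absorbing); semiring homomorphisms preserve $+,\cdot,0,1$. For a homomorphism $\varphi$, $\mathrm{Im}(\varphi)$ is its image and $\mathrm{Ker}(\varphi)=\{(f,g)\mid\varphi(f)=\varphi(g)\}$. Boolean Laurent polynomial functions: $\mathbb B=\{0,-\infty\}$ with addition $\max$ and multiplication $+$. $\mathbb B[\boldsymbol x^\pm]_{\mathrm{fcn}}=\mathbb B[x_1^\pm,\dots,x_n^\pm]_{\mathrm{fcn}}$ is the semiring (under pointwise $\max$ and $+$) of functions on $\mathbb R^n$ of the form $\boldsymbol p\mapsto\max_{i}\{\boldsymbol u_i\cdot\boldsymbol p\}$ for finitely many $\boldsymbol u_i\in\mathbb Z^n$, together with the constant function $-\infty$ (the zero element). For a finite set $A$, $(\mathbb Z\cup\{-\infty\})^A$ is a semiring with pointwise addition $\max$ and pointwise multiplication $+$. $\mathbb Z^A_{\mathrm{pos}}\cup\{-\infty\}$ is its subsemiring consisting of the maps $F$ with $\sum_{a\in A}F(a)\ge0$ (hence integer-valued) and the constant map $-\infty$. 1-dimensional tropical fans: a ray in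 $\mathbb R^n$ is a set $\{t\boldsymbol d\mid t\ge0\}$ with $\boldsymbol d\ne\mathbf 0$, and it is rational if $\boldsymbol d$ can be chosen in $\mathbb Z^n$. A 1-dimensional fan is a set $X=\{\{\mathbf 0\},\rho_1,\dots,\rho_r\}$ with $r\ge1$ and $\rho_i$ rational rays in $\mathbb R^n$. $X(1)$ is its set of rays and $|X|$ is the union of its rays. For $\rho\in X(1)$, $\boldsymbol d_\rho$ is the primitive integer direction vector. A 1-dimensional tropical fan is a 1-dimensional fan with a positive integer weight $w_\rho$ for each $\rho\in X(1)$ satisfying the balancing condition $\sum_{\rho\in X(1)}w_\rho\boldsymbol d_\rho=\mathbf 0$. The weighted evaluation map of $X$ is the semiring homomorphism $$\varphi_X:\mathbb B[\boldsymbol x^\pm]_{\mathrm{fcn}}\to\mathbb Z^{X(1)}_{\mathrm{pos}}\cup\{-\infty\},\qquad\varphi_X(f)(\rho)=w_\rho f(\boldsymbol d_\rho).$$ Its kernel is $\mathbf E(X)_{\mathbb B}=\{(f,g)\mid f|_{|X|}=g|_{|X|}\}$. Source category: objects are 1-dimensional tropical fans. For $X$ in $\mathbb R^n$ and $Y$ in $\mathbb R^m$, a morphism $\mu:X\to Y$ is a map $|X|\to|Y|$ that is the restriction of a linear map $\mathbb R^n\to\mathbb R^m$ given by an integer matrix. Target category: objects are semiring homomorphisms $\varphi:\mathbb B[x_1^\pm,\dots,x_n^\pm]_{\mathrm{fcn}}\to\mathbb Z^A_{\mathrm{pos}}\cup\{-\infty\}$, for some positive integer $n$ and some finite set $A$.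 A morphism $\varphi\to\psi$ is a semiring homomorphism $\mathrm{Im}(\varphi)\to\mathrm{Im}(\psi)$. Functor on morphisms: a morphism $\mu:X\to Y$ induces the semiring homomorphism $\mu^*:\mathbb B[\boldsymbol y^\pm]_{\mathrm{fcn}}/\mathbf E(Y)_{\mathbb B}\to\mathbb B[\boldsymbol x^\pm]_{\mathrm{fcn}}/\mathbf E(X)_{\mathbb B}$, $f\mapsto f\circ\mu$ (classes being identified with functions on $|Y|$ and $|X|$, with $\boldsymbol y=(y_1,\dots,y_m)$, $\boldsymbol x=(x_1,\dots,x_n)$). $\Phi(\mu)$ is the composition $$\mathrm{Im}(\varphi_Y)\xrightarrow{\cong}\mathbb B[\boldsymbol y^\pm]_{\mathrm{fcn}}/\mathbf E(Y)_{\mathbb B}\xrightarrow{\mu^*}\mathbb B[\boldsymbol x^\pm]_{\mathrm{fcn}}/\mathbf E(X)_{\mathbb B}\xrightarrow{\cong}\mathrm{Im}(\varphi_X),$$ where the isomorphisms are those induced by $\varphi_Y$ and $\varphi_X$. *)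

(* Defs.v *)
From HB Require Import structures.
From mathcomp Require Import all_boot all_order all_algebra finmap.
From mathcomp Require Import boolp classical_sets reals.

Set Implicit Arguments.
Unset Strict Implicit.
Unset Printing Implicit Defensive.

Import Order.TTheory GRing.Theory Num.Theory.
Local Open Scope ring_scope.
Local Open Scope classical_set_scope.

Record category := Category {
  obj :> Type;
  hom : obj -> obj -> Type;
  idm : forall X, hom X X;
  comp : forall X Y Z, hom Y Z -> hom X Y -> hom X Z;
  comp_idl : forall X Y (f : hom X Y), comp (idm Y) f = f;
  comp_idr : forall X Y (f : hom X Y), comp f (idm X) = f;
  comp_assoc : forall W X Y Z (h : hom Y Z) (g : hom X Y) (f : hom W X),
    comp h (comp g f) = comp (comp h g) f }.

Record contravariant_functor (C D : category) := ContravariantFunctor {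
  fobj :> C -> D;
  fmap : forall X Y : C, hom X Y -> hom (fobj Y) (fobj X);
  fmap_id : forall X : C, fmap (idm X) = idm (fobj X);
  fmap_comp : forall (X Y Z : C) (g : hom Y Z) (f : hom X Y),
    fmap (comp g f) = comp (fmap f) (fmap g) }.

Definition fully_faithful (C D : category) (F : contravariant_functor C D) :=
  forall X Y : C, bijective (@fmap C D F X Y).

(** K ∪ {-∞}, with [None] for -∞ *)

Definition trop (K : Type) := option K.

Section Trop.
Variable K : realDomainType.
Implicit Types x y z : trop K.

HB.instance Definition _ := Choice.copy (trop K) (option K).

Definition trop_add x y : trop K :=
  match x, y with
  | Some a, Some b => Some (Num.max a b)
  | None, _ => y
  | _, None => x
  end.

Definition trop_mul x y : trop K :=
  match x, y with
  | Some a, Some b => Some (a + b)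
  | _, _ => None
  end.

Lemma trop_addA : associative trop_add.
Proof. by move=> [x|] [y|] [z|] //=; rewrite maxA. Qed.
Lemma trop_addC : commutative trop_add.
Proof. by move=> [x|] [y|] //=; rewrite maxC. Qed.
Lemma trop_add0r : left_id None trop_add.
Proof. by case. Qed.
Lemma trop_mulA : associative trop_mul.
Proof. by move=> [x|] [y|] [z|] //=; rewrite addrA. Qed.
Lemma trop_mulC : commutative trop_mul.
Proof. by move=> [x|] [y|] //=; rewrite addrC. Qed.
Lemma trop_mul1r : left_id (Some 0) trop_mul.
Proof. by move=> [x|] //=; rewrite add0r. Qed.
Lemma trop_mulDl : left_distributive trop_mul trop_add.
Proof. by move=> [x|] [y|] [z|] //=; rewrite addr_maxl. Qed.
Lemma trop_mul0r : left_zero None trop_mul.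
Proof. by []. Qed.
Lemma trop_mulr1 : right_id (Some 0) trop_mul.
Proof. by move=> x; rewrite trop_mulC trop_mul1r. Qed.
Lemma trop_mulDr : right_distributive trop_mul trop_add.
Proof. by move=> x y z; rewrite trop_mulC trop_mulDl !(trop_mulC x). Qed.
Lemma trop_mulr0 : right_zero None trop_mul.
Proof. by move=> x; rewrite trop_mulC. Qed.

HB.instance Definition _ := GRing.isPzSemiRing.Build (trop K)
  trop_addA trop_addC trop_add0r trop_mulA trop_mul1r trop_mulr1 trop_mulDl trop_mulDr trop_mul0r trop_mulr0.
HB.instance Definition _ := GRing.PzSemiRing_hasCommutativeMul.Build (trop K) trop_mulC.

End Trop.

(** Functions with tropical values, with pointwise operations.  This is an alias
    because the library puts a pointwise semiring structure on [T -> M] only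
    when [M] is a ring. *)
Definition tfun (T : Type) (K : Type) := T -> trop K.
Identity Coercion fun_of_tfun : tfun >-> Funclass.

Section Tfun.
Variables (T : Type) (K : realDomainType).
Implicit Types f g h : tfun T K.

HB.instance Definition _ := gen_eqMixin (tfun T K).
HB.instance Definition _ := gen_choiceMixin (tfun T K).

Definition tfun_zero : tfun T K := fun=> 0.
Definition tfun_one : tfun T K := fun=> 1.
Definition tfun_add f g : tfun T K := fun p => f p + g p.
Definition tfun_mul f g : tfun T K := fun p => f p * g p.

Lemma tfun_addA : associative tfun_add.
Proof. by move=> f g h; apply/funext => p; rewrite /tfun_add addrA. Qed.
Lemma tfun_addC : commutative tfun_add.
Proof. by move=> f g; apply/funext => p; rewrite /tfun_add addrC. Qed.
Lemma tfun_add0r : left_id tfun_zero tfun_add.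
Proof. by move=> f; apply/funext => p; rewrite /tfun_add add0r. Qed.
Lemma tfun_mulA : associative tfun_mul.
Proof. by move=> f g h; apply/funext => p; rewrite /tfun_mul mulrA. Qed.
Lemma tfun_mulC : commutative tfun_mul.
Proof. by move=> f g; apply/funext => p; rewrite /tfun_mul mulrC. Qed.
Lemma tfun_mul1r : left_id tfun_one tfun_mul.
Proof. by move=> f; apply/funext => p; rewrite /tfun_mul mul1r. Qed.
Lemma tfun_mulDl : left_distributive tfun_mul tfun_add.
Proof. by move=> f g h; apply/funext => p; rewrite /tfun_mul mulrDl. Qed.
Lemma tfun_mul0r : left_zero tfun_zero tfun_mul.
Proof. by move=> f; apply/funext => p; rewrite /tfun_mul mul0r. Qed.
Lemma tfun_mulr1 : right_id tfun_one tfun_mul.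
Proof. by move=> f; rewrite tfun_mulC tfun_mul1r. Qed.
Lemma tfun_mulDr : right_distributive tfun_mul tfun_add.
Proof. by move=> f g h; rewrite tfun_mulC tfun_mulDl !(tfun_mulC f). Qed.
Lemma tfun_mulr0 : right_zero tfun_zero tfun_mul.
Proof. by move=> f; rewrite tfun_mulC tfun_mul0r. Qed.

HB.instance Definition _ := GRing.isPzSemiRing.Build (tfun T K)
  tfun_addA tfun_addC tfun_add0r tfun_mulA tfun_mul1r tfun_mulr1 tfun_mulDl tfun_mulDr tfun_mul0r tfun_mulr0.
HB.instance Definition _ := GRing.PzSemiRing_hasCommutativeMul.Build (tfun T K) tfun_mulC.

End Tfun.

Section Image.
Variables (S T : comPzSemiRingType) (phi : {rmorphism S -> T}).

Definition in_image : {pred T} := fun y => `[< exists x, phi x = y >].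

Record Im := MkIm { Im_val :> T; Im_valP : Im_val \in in_image }.

HB.instance Definition _ := [isSub for Im_val].
HB.instance Definition _ := [Choice of Im by <:].

Lemma image_semiring_closed : semiring_closed in_image.
Proof.
split; split.
- by apply/asboolP; exists 0; rewrite rmorph0.
- move=> _ _ /asboolP[x <-] /asboolP[y <-].
  by apply/asboolP; exists (x + y); rewrite rmorphD.
- by apply/asboolP; exists 1; rewrite rmorph1.
- move=> _ _ /asboolP[x <-] /asboolP[y <-].
  by apply/asboolP; exists (x * y); rewrite rmorphM.
Qed.

HB.instance Definition _ :=
  GRing.SubChoice_isSubComPzSemiRing.Build T in_image Im image_semiring_closed.

Lemma in_imageP x : phi x \in in_image.
Proof. by apply/asboolP; exists x. Qed.

Definition toIm (x : S) : Im := MkIm (in_imageP x).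

Lemma Im_preim (y : Im) : exists x, toIm x = y.
Proof. by case: y => y yP; have /asboolP[x xy] := yP; exists x; apply: val_inj. Qed.

Definition preim (y : Im) : S := sval (cid (Im_preim y)).

Lemma preimK : cancel preim toIm.
Proof. by move=> y; rewrite /preim; case: cid. Qed.

Lemma phi_preim y : phi (preim y) = Im_val y.
Proof. by have /(congr1 Im_val) := preimK y. Qed.

End Image.

(** If Ker(phi) ⊆ Ker(psi), the homomorphism Im(phi) -> Im(psi) sending phi(x)
    to psi(x); it is an isomorphism when the kernels agree. *)
Section ImTransfer.
Variables (S T T' : comPzSemiRingType).
Variables (phi : {rmorphism S -> T}) (psi : {rmorphism S -> T'}).
Hypothesis ker_sub : forall x y, phi x = phi y -> psi x = psi y.

Definition Im_transfer (y : Im phi) : Im psi := toIm psi (preim y).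

Lemma Im_transferE x : Im_transfer (toIm phi x) = toIm psi x.
Proof. by apply: val_inj => /=; apply: ker_sub; rewrite phi_preim. Qed.

Lemma transfer_additive : nmod_morphism Im_transfer.
Proof.
split.
  rewrite (_ : 0 = toIm phi 0) ?Im_transferE; last by apply: val_inj; rewrite /= !rmorph0.
  by apply: val_inj; rewrite /= !rmorph0.
move=> x y; have [a <-] := Im_preim x; have [b <-] := Im_preim y.
rewrite (_ : toIm phi a + toIm phi b = toIm phi (a + b)); last first.
  by apply: val_inj; rewrite /= !rmorphD.
by rewrite !Im_transferE; apply: val_inj; rewrite /= !rmorphD.
Qed.

Lemma transfer_multiplicative : monoid_morphism Im_transfer.
Proof.
split.
  rewrite (_ : 1 = toIm phi 1) ?Im_transferE; last by apply: val_inj; rewrite /= !rmorph1.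
  by apply: val_inj; rewrite /= !rmorph1.
move=> x y; have [a <-] := Im_preim x; have [b <-] := Im_preim y.
rewrite (_ : toIm phi a * toIm phi b = toIm phi (a * b)); last first.
  by apply: val_inj; rewrite /= !rmorphM.
by rewrite !Im_transferE; apply: val_inj; rewrite /= !rmorphM.
Qed.

HB.instance Definition _ :=
  GRing.isNmodMorphism.Build (Im phi) (Im psi) Im_transfer transfer_additive.
HB.instance Definition _ :=
  GRing.isMonoidMorphism.Build (Im phi) (Im psi) Im_transfer transfer_multiplicative.

Definition Im_transfer_hom : {rmorphism Im phi -> Im psi} := Im_transfer.

End ImTransfer.

Lemma Im_transferK (S T T' : comPzSemiRingType)
    (phi : {rmorphism S -> T}) (psi : {rmorphism S -> T'})
    (sub : forall x y, phi x = phi y -> psi x = psi y)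
    (sub' : forall x y, psi x = psi y -> phi x = phi y) :
  cancel (Im_transfer_hom sub) (Im_transfer_hom sub').
Proof. by move=> y; have [x <-] := Im_preim y; rewrite /= !Im_transferE. Qed.

Lemma rmorphism_ext (S T : pzSemiRingType) (f g : {rmorphism S -> T}) :
  f =1 g -> f = g.
Proof.
case: f g => [f [[f1] [f2]]] [g [[g1] [g2]]] /= /funext E.
case: _ / E in g1 g2 *.
by rewrite (Prop_irrelevance f1 g1) (Prop_irrelevance f2 g2).
Qed.

Section Laurent.
Variable R : realType.

Definition dot (K : pzRingType) n (u v : 'rV[K]_n) : K := \sum_i u 0 i * v 0 i.

Definition intmx m n (A : 'M[int]_(m, n)) : 'M[R]_(m, n) := map_mx intr A.

Variable n : nat.

(** Sums in [tfun] are pointwise maxima; the empty sum is the constant -∞. *)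
Definition laurent : {pred tfun 'rV[R]_n R} := fun f =>
  `[< exists us : seq 'rV[int]_n,
        f = fun p => \sum_(u <- us) (Some (dot (intmx u) p) : trop R) >].

Lemma laurent_semiring_closed : semiring_closed laurent.
Proof.
split; split.
- by apply/asboolP; exists [::]; apply/funext => p; rewrite big_nil.
- move=> _ _ /asboolP[us ->] /asboolP[vs ->]; apply/asboolP; exists (us ++ vs).
  by apply/funext => p; rewrite big_cat.
- apply/asboolP; exists [:: 0]; apply/funext => p; rewrite big_seq1.
  by congr Some; rewrite /dot big1 // => i _; rewrite !mxE mul0r.
- move=> _ _ /asboolP[us ->] /asboolP[vs ->]; apply/asboolP.
  exists [seq u + v | u <- us, v <- vs]; apply/funext => p.
  rewrite big_allpairs_dep /= [LHS]/GRing.mul /= /tfun_mul mulr_suml.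
  apply: eq_bigr => u _; rewrite mulr_sumr; apply: eq_bigr => v _.
  congr Some; rewrite /dot -big_split /=; apply: eq_bigr => i _.
  by rewrite !mxE rmorphD mulrDl.
Qed.

Record Bfcn := MkBfcn { Bfcn_val :> tfun 'rV[R]_n R; BfcnP : Bfcn_val \in laurent }.

HB.instance Definition _ := [isSub for Bfcn_val].
HB.instance Definition _ := [Choice of Bfcn by <:].
HB.instance Definition _ := GRing.SubChoice_isSubComPzSemiRing.Build
  (tfun 'rV[R]_n R) laurent Bfcn laurent_semiring_closed.

End Laurent.

Section Zpos.
Variable A : finType.

Definition zpos : {pred tfun A int} := fun F =>
  `[< F = (fun=> None) \/
      exists G : A -> int, F = (fun a => Some (G a)) /\ 0 <= \sum_a G a >].

Lemma zpos_semiring_closed : semiring_closed zpos.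
Proof.
split; split.
- by apply/asboolP; left.
- move=> f g /asboolP[->|[F [-> F0]]] /asboolP[->|[G [-> G0]]]; apply/asboolP.
  + by left.
  + by right; exists G; split.
  + by right; exists F; split.
  + right; exists (fun a => Num.max (F a) (G a)); split=> //.
    by apply: le_trans F0 _; apply: ler_sum => a _; rewrite le_max lexx.
- by apply/asboolP; right; exists (fun=> 0); split=> //; rewrite big1.
- move=> f g /asboolP[->|[F [-> F0]]] /asboolP[->|[G [-> G0]]]; apply/asboolP.
  + by left.
  + by left.
  + by left.
  + by right; exists (fun a => F a + G a); split=> //; rewrite big_split addr_ge0.
Qed.

Record Zpos := MkZpos { Zpos_val :> tfun A int; ZposP : Zpos_val \in zpos }.

HB.instance Definition _ := [isSub for Zpos_val].
HB.instance Definition _ := [Choice of Zpos by <:].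
HB.instance Definition _ := GRing.SubChoice_isSubComPzSemiRing.Build
  (tfun A int) zpos Zpos zpos_semiring_closed.

End Zpos.

Section Fans.
Variable R : realType.

Section Dim.
Variable n : nat.

Definition ray (d : 'rV[R]_n) : set 'rV[R]_n := [set t *: d | t in [set t | 0 <= t]].

Definition rational_ray (rho : set 'rV[R]_n) :=
  exists d : 'rV[int]_n, d != 0 /\ rho = ray (intmx R d).

Definition primitive (d : 'rV[int]_n) := \big[gcdn/0%N]_i absz (d 0 i) == 1%N.

(** The primitive integer direction of [rho]; a junk value 0 if [rho] is not a
    rational ray. *)
Definition dir (rho : set 'rV[R]_n) : 'rV[int]_n :=
  xget 0 [set d | primitive d /\ rho = ray (intmx R d)].

(** The cone {0}, which belongs to every fan, is left implicit. *)
Record tropical_fan := TropicalFan {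
  rays : {fset set 'rV[R]_n};
  rays_neq0 : rays != fset0;
  rays_rational : forall rho : rays, rational_ray (val rho);
  weight : rays -> nat;
  weight_gt0 : forall rho : rays, (0 < weight rho)%N;
  balanced : \sum_(rho : rays) dir (val rho) *+ weight rho = 0 }.

Definition support (X : tropical_fan) : set 'rV[R]_n :=
  [set p | exists rho : rays X, val rho p].

End Dim.

Lemma dirP n (rho : set 'rV[R]_n) : rational_ray rho ->
  primitive (dir rho) /\ rho = ray (intmx R (dir rho)).
Proof.
move=> [d [d0 rhoE]].
pose g := \big[gcdn/0%N]_i absz (d 0 i).
have gdvd i : (g %| absz (d 0%R i))%N by rewrite /g (bigD1 i) //= dvdn_gcdl.
have g0 : (0 < g)%N.
  rewrite lt0n; apply: contra d0 => /eqP g0; apply/eqP/rowP => i.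
  by have := gdvd i; rewrite g0 dvd0n absz_eq0 mxE => /eqP.
pose e : 'rV[int]_n := \row_i (d 0%R i %/ g%:Z)%Z.
have de : d = g%:Z *: e.
  by apply/rowP => i; rewrite !mxE mulrC divzK // dvdzE /= gdvd.
have eprim : primitive e.
  rewrite /primitive -(eqn_pmul2l g0) muln1; apply/eqP.
  rewrite (big_endo (muln g)) ?muln0 //; last by move=> x y; rewrite muln_gcdr.
  apply: eq_bigr => i _.
  by rewrite -[RHS]/(absz (d 0 i)) [in RHS]de [in RHS]mxE abszM.
apply: (@xgetPex _ 0 [set d | primitive d /\ rho = ray (intmx R d)]).
exists e; split => //.
rewrite rhoE; have gR0 : (0 : R) < g%:R by rewrite ltr0n.
have -> : intmx R d = g%:R *: intmx R e.
  by apply/rowP => i; rewrite {1}de !mxE rmorphM.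
apply/seteqP; split=> _ [t /= t0 <-].
  by exists (t * g%:R); rewrite /= ?mulr_ge0 ?ler0n // scalerA.
exists (t / g%:R); rewrite /= ?divr_ge0 ?ler0n // scalerA divfK //.
by rewrite gt_eqF.
Qed.

Section Evaluation.
Variables (n : nat) (X : tropical_fan n).

(** w f(d) is an integer or -∞ since d is an integer vector, so that [Num.floor]
    merely retypes it: see [weighted_evalE]. *)
Definition weighted_eval (f : Bfcn R n) : tfun (rays X) int := fun rho =>
  omap (fun y => Num.floor ((weight rho)%:R * y)) (f (intmx R (dir (val rho)))).

Lemma sum_omap (K L : realDomainType) (g : K -> L) (I : Type) (s : seq I)
    (F : I -> K) : {homo g : x y / x <= y} ->
  omap g (\sum_(i <- s) (Some (F i) : trop K)) =
  \sum_(i <- s) (Some (g (F i)) : trop L).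
Proof.
move=> gle; apply: (big_morph (omap g : trop K -> trop L)) => //.
move=> [x|] [y|] //=; congr Some.
by case: (leP x y) => [/gle xy|/ltW/gle xy]; [rewrite max_r|rewrite max_l].
Qed.

Lemma dot_intmx m (u d : 'rV[int]_m) :
  dot (intmx R u) (intmx R d) = (dot u d)%:~R.
Proof.
by rewrite /dot rmorph_sum; apply: eq_bigr => i _; rewrite !mxE rmorphM.
Qed.

Lemma Bfcn_int (f : Bfcn R n) (d : 'rV[int]_n) :
  exists y : trop int, f (intmx R d) = omap intr y.
Proof.
case: f => f /= /asboolP[us ->]; exists (\sum_(u <- us) (Some (dot u d) : trop int)).
rewrite sum_omap; last by move=> x y; rewrite ler_int.
by apply: eq_bigr => u _; rewrite dot_intmx.
Qed.

Lemma floor_intrM (w : nat) (y : int) : Num.floor (w%:R * y%:~R : R) = w%:Z * y.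
Proof. by rewrite -[w%:R]/(w%:Z%:~R) -rmorphM /= intrKfloor. Qed.

Lemma weighted_evalE (f : Bfcn R n) (rho : rays X) :
  omap intr (weighted_eval f rho) =
  omap (fun y => (weight rho)%:R * y) (f (intmx R (dir (val rho)))).
Proof.
rewrite /weighted_eval; have [[y|] ->] := Bfcn_int f (dir (val rho)) => //=.
by rewrite floor_intrM rmorphM.
Qed.

Lemma dotMnl (K : pzRingType) m (u v : 'rV[K]_m) k : dot u (v *+ k) = k%:R * dot u v.
Proof.
rewrite /dot mulr_sumr; apply: eq_bigr => i _.
by rewrite mulmxnE mulrnAr mulr_natl.
Qed.

Lemma weighted_eval_zpos (f : Bfcn R n) : weighted_eval f \in @zpos (rays X).
Proof.
case: f => f fP; have /asboolP[us fE] := fP; apply/asboolP.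
pose G (d : 'rV[int]_n) := \sum_(u <- us) (Some (dot u d) : trop int).
have fG d : f (intmx R d) = omap intr (G d).
  rewrite fE sum_omap; last by move=> x y; rewrite ler_int.
  by apply: eq_bigr => u _; rewrite dot_intmx.
case: us {fE} @G fG => [|u us] G fG.
  by left; apply/funext => rho; rewrite /weighted_eval /= fG /G big_nil.
right.
have GE d : exists2 y, G d = Some y & dot u d <= y.
  rewrite /G big_cons; case: (\sum_(_ <- us) _) => [z|] /=.
    by exists (Num.max (dot u d) z) => //; rewrite le_max lexx.
  by exists (dot u d).
pose y d := odflt 0 (G d).
have Gy d : G d = Some (y d) by rewrite /y; have [z ->] := GE d.
exists (fun rho => (weight rho)%:Z * y (dir (val rho))); split.
  by apply/funext => rho; rewrite /weighted_eval /= fG Gy /= floor_intrM.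
have sum0 : 0 = \sum_(rho : rays X) (weight rho)%:Z * dot u (dir (val rho)).
  transitivity (dot u (\sum_(rho : rays X) dir (val rho) *+ weight rho)).
    by rewrite balanced /dot big1 // => i _; rewrite mxE mulr0.
  transitivity (\sum_(rho : rays X) dot u (dir (val rho) *+ weight rho)).
    rewrite /dot exchange_big /=; apply: eq_bigr => i _.
    by rewrite summxE mulr_sumr.
  by apply: eq_bigr => rho _; rewrite dotMnl natz.
rewrite [leLHS]sum0; apply: ler_sum => rho _; apply: ler_wpM2l => //.
by have [z + uz] := GE (dir (val rho)); rewrite Gy => -[->].
Qed.

Definition phi_fun (f : Bfcn R n) : Zpos (rays X) := MkZpos (weighted_eval_zpos f).

Lemma phi_additive : nmod_morphism phi_fun.
Proof.
split; first by apply: val_inj; apply/funext.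
move=> f g; apply: val_inj; apply/funext => rho /=.
rewrite /weighted_eval [RHS]/GRing.add /= /tfun_add /=.
rewrite [X in omap _ X]/GRing.add /= /tfun_add /=.
set d := dir _.
have [[x|] ->] := Bfcn_int f d; have [[y|] ->] := Bfcn_int g d => //=.
have -> : Num.max x%:~R y%:~R = (Num.max x y)%:~R :> R.
  by rewrite !maxEle ler_int; case: ifP.
by congr Some; rewrite !floor_intrM maxr_pMr.
Qed.

Lemma phi_multiplicative : monoid_morphism phi_fun.
Proof.
split.
  apply: val_inj; apply/funext => rho /=; rewrite /weighted_eval /=.
  by congr Some; rewrite mulr0 floor0.
move=> f g; apply: val_inj; apply/funext => rho /=.
rewrite /weighted_eval [RHS]/GRing.mul /= /tfun_mul /=.
rewrite [X in omap _ X]/GRing.mul /= /tfun_mul /=.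
set d := dir _.
have [[x|] ->] := Bfcn_int f d; have [[y|] ->] := Bfcn_int g d => //=.
by rewrite -rmorphD; congr Some; rewrite !floor_intrM mulrDr.
Qed.

HB.instance Definition _ :=
  GRing.isNmodMorphism.Build (Bfcn R n) (Zpos (rays X)) phi_fun phi_additive.
HB.instance Definition _ :=
  GRing.isMonoidMorphism.Build (Bfcn R n) (Zpos (rays X)) phi_fun phi_multiplicative.

Definition phi : {rmorphism Bfcn R n -> Zpos (rays X)} := phi_fun.

(** Restriction to |X|.  Its image, the functions on |X| that are restrictions
    of elements of B[x^±]_fcn, is the quotient B[x^±]_fcn / E(X)_B. *)
Definition restr_fun (f : Bfcn R n) : tfun (support X) R := fun p => f (val p).

Lemma restr_additive : nmod_morphism restr_fun.
Proof. by split. Qed.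
Lemma restr_multiplicative : monoid_morphism restr_fun.
Proof. by split. Qed.

HB.instance Definition _ :=
  GRing.isNmodMorphism.Build (Bfcn R n) (tfun (support X) R) restr_fun restr_additive.
HB.instance Definition _ :=
  GRing.isMonoidMorphism.Build (Bfcn R n) (tfun (support X) R) restr_fun
    restr_multiplicative.

Definition restr : {rmorphism Bfcn R n -> tfun (support X) R} := restr_fun.

Lemma Bfcn_homogeneous (f : Bfcn R n) (t : R) (p : 'rV[R]_n) : 0 <= t ->
  f (t *: p) = omap (fun y => t * y) (f p).
Proof.
move=> t0; case: f => f /= /asboolP[us ->].
rewrite sum_omap; last by move=> x y xy; rewrite ler_wpM2l.
apply: eq_bigr => u _; congr Some; rewrite /dot mulr_sumr.
by apply: eq_bigr => i _; rewrite [(t *: p) 0 i]mxE mulrCA.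
Qed.

Lemma phi_ker (f g : Bfcn R n) : phi f = phi g <-> restr f = restr g.
Proof.
split=> [/(congr1 (@Zpos_val _)) fg|fg]; last first.
  apply: val_inj; apply/funext => rho /=; rewrite /weighted_eval.
  have pX : intmx R (dir (val rho)) \in support X.
    apply/asboolP; exists rho; have [_ E] := dirP (rays_rational rho).
    by rewrite {1}E; exists 1; rewrite /= ?ler01 // scale1r.
  by have := congr1 (fun h : tfun (support X) R => h (exist (fun p => p \in support X) _ pX)) fg; rewrite /= /restr_fun /= => ->.
apply/funext => -[p pX] /=; rewrite /restr_fun /=.
have /asboolP[rho] := pX; have [_ E] := dirP (rays_rational rho).
rewrite {1}E => -[t /= t0 <-]; rewrite !Bfcn_homogeneous //; congr (omap _ _).
have /(congr1 (fun y => omap (intr : int -> R) y)) := congr1 (fun h : tfun (rays X) int => h rho) fg.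
rewrite /= !weighted_evalE.
have w0 : (weight rho)%:R != 0 :> R by rewrite pnatr_eq0 -lt0n weight_gt0.
by case: (f _) => [x|]; case: (g _) => [y|] //= [] /(mulfI w0) ->.
Qed.

End Evaluation.

Section FanHom.
Variables (n m : nat) (X : tropical_fan n) (Y : tropical_fan m).

(** Points are row vectors, so that a linear map is p |-> p *m A. *)
Definition fan_hom := {mu : support X -> support Y |
  exists A : 'M[int]_(n, m), forall p, val (mu p) = val p *m intmx R A}.

Lemma fan_hom_ext (mu nu : fan_hom) : sval mu =1 sval nu -> mu = nu.
Proof. by move=> /funext; exact: eq_sig_hprop (fun _ => @Prop_irrelevance _) _ _. Qed.

Lemma dot_mulmx_tr (A : 'M[int]_(n, m)) (u : 'rV[int]_m) (p : 'rV[R]_n) :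
  dot (intmx R u) (p *m intmx R A) = dot (intmx R (u *m A^T)) p.
Proof.
rewrite /dot; under eq_bigr do rewrite [(p *m _) _ _]mxE mulr_sumr.
rewrite exchange_big /=; apply: eq_bigr => i _; rewrite !mxE rmorph_sum mulr_suml.
by apply: eq_bigr => j _; rewrite !mxE rmorphM mulrA mulrAC.
Qed.

Lemma Bfcn_comp (A : 'M[int]_(n, m)) (f : Bfcn R m) :
  exists g : Bfcn R n, forall p, g p = f (p *m intmx R A).
Proof.
case: f => f /= /asboolP[us ->].
have gP : (fun p => \sum_(u <- [seq u *m A^T | u <- us])
                      (Some (dot (intmx R u) p) : trop R)) \in @laurent R n.
  by apply/asboolP; eexists.
exists (MkBfcn gP) => p /=; rewrite big_map; apply: eq_bigr => u _.
by rewrite dot_mulmx_tr.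
Qed.

Lemma pullback_subproof (mu : fan_hom) (F : Im (restr Y)) :
  (fun p => Im_val F (sval mu p)) \in in_image (restr X).
Proof.
have [f <-] := Im_preim F; case: mu => mu [A muA] /=.
have [g gE] := Bfcn_comp A f; apply/asboolP; exists g.
by apply/funext => p; rewrite /= /restr_fun gE muA.
Qed.

Definition pullback_fun (mu : fan_hom) (F : Im (restr Y)) : Im (restr X) :=
  MkIm (pullback_subproof mu F).

Variable mu : fan_hom.
Lemma pullback_additive : nmod_morphism (pullback_fun mu).
Proof. by split=> [|F G]; apply: val_inj. Qed.
Lemma pullback_multiplicative : monoid_morphism (pullback_fun mu).
Proof. by split=> [|F G]; apply: val_inj. Qed.

HB.instance Definition _ := GRing.isNmodMorphism.Build
  (Im (restr Y)) (Im (restr X)) (pullback_fun mu) pullback_additive.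
HB.instance Definition _ := GRing.isMonoidMorphism.Build
  (Im (restr Y)) (Im (restr X)) (pullback_fun mu) pullback_multiplicative.

Definition pullback : {rmorphism Im (restr Y) -> Im (restr X)} := pullback_fun mu.

Definition Phi_hom : {rmorphism Im (phi Y) -> Im (phi X)} :=
  Im_transfer_hom (fun f g => (phi_ker X f g).2) \o pullback \o
  Im_transfer_hom (fun f g => (phi_ker Y f g).1).

Lemma Phi_homE (f : Bfcn R m) (g : Bfcn R n) :
  (forall p : support X, g (val p) = f (val (sval mu p))) ->
  Phi_hom (toIm (phi Y) f) = toIm (phi X) g.
Proof.
move=> gf; rewrite /= (Im_transferE (fun f g => (phi_ker Y f g).1)).
rewrite (_ : pullback_fun _ _ = toIm (restr X) g).
  by rewrite (Im_transferE (fun f g => (phi_ker X f g).2)).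
by apply: val_inj; apply/funext => p; rewrite /= /restr_fun gf.
Qed.

End FanHom.

Definition fan_id n (X : tropical_fan n) : fan_hom X X.
Proof.
exists id; exists 1%:M => p.
by rewrite /intmx map_mx1 mulmx1.
Defined.

Definition fan_comp n m k (X : tropical_fan n) (Y : tropical_fan m)
  (Z : tropical_fan k) (nu : fan_hom Y Z) (mu : fan_hom X Y) : fan_hom X Z.
Proof.
exists (sval nu \o sval mu).
case: nu mu => [nu [B nuB]] [mu [A muA]]; exists (A *m B) => p /=.
by rewrite nuB muA /intmx map_mxM mulmxA.
Defined.

Definition fan_category : category.
Proof.
refine (@Category {n : nat & tropical_fan n}
  (fun X Y => fan_hom (projT2 X) (projT2 Y)) (fun X => fan_id (projT2 X))
  (fun X Y Z => @fan_comp _ _ _ (projT2 X) (projT2 Y) (projT2 Z)) _ _ _).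
- by move=> X Y mu; apply: fan_hom_ext.
- by move=> X Y mu; apply: fan_hom_ext.
- by move=> W X Y Z h g f; apply: fan_hom_ext.
Defined.

Record semiring_hom := SemiringHom {
  sh_dim : nat;
  sh_dim_gt0 : (0 < sh_dim)%N;
  sh_set : finType;
  sh_map :> {rmorphism Bfcn R sh_dim -> Zpos sh_set} }.

Definition semiring_hom_category : category.
Proof.
refine (@Category semiring_hom
  (fun phi psi => {rmorphism Im phi -> Im psi})
  (fun phi => idfun)
  (fun phi psi chi g f => g \o f) _ _ _).
- by move=> X Y f; apply: rmorphism_ext.
- by move=> X Y f; apply: rmorphism_ext.
- by move=> W X Y Z h g f; apply: rmorphism_ext.
Defined.

Lemma fan_dim_gt0 n (X : tropical_fan n) : (0 < n)%N.
Proof.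
case: n X => // X; have /fset0Pn[rho rhoX] := rays_neq0 X.
have [d [/eqP[]]] := rays_rational (FSetSub rhoX).
by apply/rowP => -[].
Qed.

Definition Phi_obj (X : fan_category) : semiring_hom_category :=
  SemiringHom (fan_dim_gt0 (projT2 X)) (phi (projT2 X)).

Definition Phi : contravariant_functor fan_category semiring_hom_category.
Proof.
refine (@ContravariantFunctor fan_category semiring_hom_category Phi_obj
  (fun X Y mu => Phi_hom mu) _ _).
- move=> [n X] /=; apply: rmorphism_ext => y; have [f <-] := Im_preim y.
  rewrite /= (Im_transferE (fun f g => (phi_ker X f g).1)).
  rewrite (_ : pullback_fun _ _ = toIm (restr X) f); last exact: val_inj.
  by rewrite (Im_transferE (fun f g => (phi_ker X f g).2)).
- move=> [n X] [m Y] [k Z] nu mu /=; apply: rmorphism_ext => y.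
  rewrite /=; set F := Im_transfer _ y.
  have [f fE] := Im_preim (pullback_fun nu F).
  rewrite -fE (Im_transferE (fun f g => (phi_ker Y f g).2)).
  rewrite (Im_transferE (fun f g => (phi_ker Y f g).1)) fE.
  by congr Im_transfer; apply: val_inj.
Defined.

End Fans.

(* Main.v *)
From Pilot Require Import Defs.
From HB Require Import structures.
From mathcomp Require Import all_boot all_order all_algebra finmap lra.
From mathcomp Require Import boolp classical_sets reals.

(** A point of [|Y|] is determined by the values at it of the coordinate
    monomials [y_j], so a morphism [X -> Y] of fans can be read off from the homomorphism it
    induces: this is faithfulness.

    For fullness, let [eta : Im (phi Y) -> Im (phi X)].  A monomial [y^u] is
    invertible, so [eta] sends its class to a unit.  The balancing condition
    makes units rigid ([unit_mono]): if [f g = 1] on [|X|], choose exponents [u]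
    of [f] and [v] of [g]; then [(u + v) . p <= 0] for [p] in [|X|], as the
    semiring unit [1] is the constant function [0], while the weighted sum of [(u + v) . d_rho] over the rays vanishes, so all
    these inequalities are equalities and [f] coincides with [x^u] on [|X|].
    Applying this to the coordinates [y_j] gives an integer matrix [A] such that
    [eta] is the substitution [f |-> f (p *m A)], because [eta] is
    multiplicative on monomials and every polynomial function is a sum of
    monomials ([hom_pullback]).

    It remains to see that [p |-> p *m A] maps [|X|] into [|Y|].  If it sent some
    [p] to a point outside [|Y|], there would be two polynomial functions which
    agree on [|Y|] but not at that point ([separation]); their classes in
    [Im (phi Y)] would be equal, but not their images under [eta].  Separating a
    point from a single ray is linear algebra, and pairs separating it from
    several sets are combined by the twisted product
    [(f1 f2 + g1 g2, f1 g2 + g1 f2)], whose entries differ wherever those of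
    both factors do ([trop_twisted_product]). *)

Set Implicit Arguments.
Unset Strict Implicit.
Unset Printing Implicit Defensive.

Import Order.TTheory GRing.Theory Num.Theory.
Import Pilot.Defs.
Local Open Scope ring_scope.

(** * Semirings *)

Section ToIm.
Variables (S T : comPzSemiRingType) (phi : {rmorphism S -> T}).

Lemma toIm_additive : nmod_morphism (toIm phi).
Proof. by split=> [|x y]; apply: val_inj; rewrite /= (rmorph0, rmorphD). Qed.

Lemma toIm_multiplicative : monoid_morphism (toIm phi).
Proof. by split=> [|x y]; apply: val_inj; rewrite /= (rmorph1, rmorphM). Qed.

HB.instance Definition _ :=
  GRing.isNmodMorphism.Build S (Im phi) (toIm phi) toIm_additive.
HB.instance Definition _ :=
  GRing.isMonoidMorphism.Build S (Im phi) (toIm phi) toIm_multiplicative.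

End ToIm.

Lemma trop_addE (K : realDomainType) (x y : K) :
  (Some x : trop K) + (Some y : trop K) = Some (Num.max x y).
Proof. by []. Qed.

Lemma trop_mulE (K : realDomainType) (x y : K) :
  (Some x : trop K) * (Some y : trop K) = Some (x + y).
Proof. by []. Qed.

(** This is the primality of the trivial congruence of the max-plus semiring.
    For finite values with, say, [a < b] and [c < d], the left side is [b + d],
    which exceeds both terms on the right. *)
Lemma trop_twisted_product (K : realDomainType) (a b c d : trop K) :
  a * c + b * d = a * d + b * c -> a = b \/ c = d.
Proof.
case: a b c d => [a|] [b|] [c|] [d|]; rewrite -?[None]/(0 : trop K);
  rewrite ?(mul0r, mulr0, add0r, addr0) ?trop_mulE ?trop_addE => //;
  try by [left|right].
all: try by case=> /addrI ->; right.
all: try by case=> /addIr ->; left.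
case=> E; case: (ltgtP a b) => [ab|ba|->]; last (by left);
  case: (ltgtP c d) => [cd|dc|->]; try (by right); exfalso;
  by move: E; rewrite !maxEle; do 2 (case: leP => ?); move=> ?; lra.
Qed.

(** * The standard bilinear form *)

Section Dot.
Variables (K : comPzRingType) (n : nat).
Implicit Types u v w : 'rV[K]_n.

Lemma dotDl u v w : dot (u + v) w = dot u w + dot v w.
Proof. by rewrite /dot -big_split; apply: eq_bigr => i _; rewrite mxE mulrDl. Qed.

Lemma dotC u v : dot u v = dot v u.
Proof. by apply: eq_bigr => i _; rewrite mulrC. Qed.

Lemma dotZl t u v : dot (t *: u) v = t * dot u v.
Proof. by rewrite /dot mulr_sumr; apply: eq_bigr => i _; rewrite mxE mulrA. Qed.

Lemma dotZr t u v : dot u (t *: v) = t * dot u v.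
Proof. by rewrite dotC dotZl dotC. Qed.

Lemma dot0l v : dot 0 v = 0.
Proof. by rewrite /dot big1 // => i _; rewrite mxE mul0r. Qed.

Lemma dotNl u v : dot (- u) v = - dot u v.
Proof. by rewrite -scaleN1r dotZl mulN1r. Qed.

Lemma dotBl u v w : dot (u - v) w = dot u w - dot v w.
Proof. by rewrite dotDl dotNl. Qed.

Lemma dot_sumr I (s : seq I) u (F : I -> 'rV[K]_n) :
  dot u (\sum_(i <- s) F i) = \sum_(i <- s) dot u (F i).
Proof.
rewrite /dot exchange_big /=; apply: eq_bigr => j _.
by rewrite summxE mulr_sumr.
Qed.

Lemma dot_delta j u : dot (delta_mx 0 j) u = u 0 j.
Proof.
rewrite /dot (bigD1 j) //= mxE !eqxx mul1r big1 ?addr0 // => i ij.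
by rewrite mxE (negPf ij) andbF mul0r.
Qed.

End Dot.

Lemma dot_eq0 (K : realDomainType) n (u : 'rV[K]_n) : dot u u = 0 -> u = 0.
Proof.
move=> /eqP; rewrite psumr_eq0 => [/allP u0|i _]; last by rewrite -expr2 sqr_ge0.
apply/rowP => i; rewrite mxE; apply/eqP.
by have := u0 i; rewrite mem_index_enum mulf_eq0 orbb => /(_ isT)/implyP ->.
Qed.

Lemma dot_ge0 (K : realDomainType) n (u : 'rV[K]_n) : 0 <= dot u u.
Proof. by apply: sumr_ge0 => i _; rewrite -expr2 sqr_ge0. Qed.

(** * Monomials *)

Section Monomials.
Variables (R : realType) (n : nat).
Implicit Types (u v : 'rV[int]_n) (f g : Bfcn R n) (p : 'rV[R]_n).

Lemma mono_subproof u :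
  (fun p => Some (dot (intmx R u) p) : trop R) \in @laurent R n.
Proof. by apply/asboolP; exists [:: u]; apply/funext => p; rewrite big_seq1. Qed.

Definition mono u : Bfcn R n := MkBfcn (mono_subproof u).

Lemma mono0 : mono 0 = 1.
Proof.
apply: val_inj; apply/funext => p /=.
by rewrite (_ : intmx R 0 = 0) ?dot0l //; apply: map_mx0.
Qed.

Lemma monoD u v : mono (u + v) = mono u * mono v.
Proof.
apply: val_inj; apply/funext => p /=.
by rewrite (_ : intmx R _ = intmx R u + intmx R v) ?dotDl //; apply: map_mxD.
Qed.

Lemma Bfcn_addE f g p : (f + g) p = f p + g p.
Proof. by []. Qed.

Lemma Bfcn_mulE f g p : (f * g) p = f p * g p.
Proof. by []. Qed.

Lemma Bfcn_sumE I (s : seq I) (F : I -> Bfcn R n) p :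
  (\sum_(i <- s) F i : Bfcn R n) p = \sum_(i <- s) F i p.
Proof. by apply: (big_morph (fun f : Bfcn R n => f p)). Qed.

Lemma mono_gen f : exists us, f = \sum_(u <- us) mono u.
Proof.
have /asboolP[us fE] := BfcnP f; exists us.
by apply: val_inj; apply/funext => p /=; rewrite fE Bfcn_sumE.
Qed.

End Monomials.

(** * Polynomial functions on a tropical fan *)

Section Fan.
Variables (R : realType) (n : nat) (X : tropical_fan R n).
Implicit Types (u v : 'rV[int]_n) (f g : Bfcn R n) (p : 'rV[R]_n).

Lemma support_dir (rho : rays X) : support X (intmx R (dir (val rho))).
Proof.
exists rho; have [_ rhoE] := dirP (rays_rational rho).
by rewrite {1}rhoE; exists 1; rewrite /= ?scale1r.
Qed.

Lemma supportE p : support X p ->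
  exists (rho : rays X) (t : R), 0 <= t /\ p = t *: intmx R (dir (val rho)).
Proof.
move=> [rho rhop]; have [_ rhoE] := dirP (rays_rational rho).
by move: rhop; rewrite rhoE => -[t t0 <-]; exists rho, t.
Qed.

Lemma supportZ (t : R) p : 0 <= t -> support X p -> support X (t *: p).
Proof.
move=> t0 [rho rhop]; exists rho; have [_ rhoE] := dirP (rays_rational rho).
move: rhop; rewrite rhoE => -[s s0 <-].
by exists (t * s); rewrite /= ?mulr_ge0 // scalerA.
Qed.

Lemma toIm_phiP f g :
  toIm (phi X) f = toIm (phi X) g <-> (forall p, support X p -> f p = g p).
Proof.
split=> [/(congr1 val) /= /phi_ker fg p pX|fg].
  by have := congr1 (fun h : tfun (support X) R => h (exist _ p (mem_set pX))) fg.
apply/val_inj/phi_ker/funext => -[p pX]; rewrite /= /restr_fun /=.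
exact/fg/set_mem.
Qed.

Lemma balanced_dot u :
  \sum_(rho : rays X) (weight rho)%:R * dot u (dir (val rho)) = 0.
Proof.
transitivity (dot u (\sum_(rho : rays X) dir (val rho) *+ weight rho)).
  by rewrite dot_sumr; apply: eq_bigr => rho _; rewrite -scaler_nat dotZr.
by rewrite balanced dotC dot0l.
Qed.

(** Nonpositive terms with sum zero all vanish, and a linear form is determined
    on the support by its values at the primitive vectors. *)
Lemma balanced_le0 u : (forall rho : rays X, dot u (dir (val rho)) <= 0) ->
  forall p, support X p -> dot (intmx R u) p = 0.
Proof.
move=> ule p /supportE[rho [t [_ ->]]]; rewrite dotZr dot_intmx.
suff /eqP: (weight rho)%:R * dot u (dir (val rho)) = 0.
  rewrite mulf_eq0 pnatr_eq0 -[weight rho == 0%N]negbK -lt0n weight_gt0 /=.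
  by move=> /eqP ->; rewrite mulr0.
have := balanced_dot u; move/(congr1 -%R); rewrite oppr0 -sumrN => /eqP.
rewrite psumr_eq0 => [/allP/(_ rho)|sigma _].
  by rewrite mem_index_enum oppr_eq0 => /(_ isT)/eqP.
by rewrite oppr_ge0 mulr_ge0_le0 ?ler0n.
Qed.

(** [f + mono R u = f] says that the monomial [u] lies below [f] everywhere. *)
Lemma mono_le f u p : f + mono R u = f ->
  exists2 y, f p = Some y & dot (intmx R u) p <= y.
Proof.
move=> /(congr1 (fun h : Bfcn R n => h p)).
rewrite Bfcn_addE /=; case: (f p) => [y|] //=; rewrite trop_addE => -[E].
by exists y => //; rewrite -E le_max lexx orbT.
Qed.

Lemma mono_lower f p : f p <> 0 -> exists u, f + mono R u = f.
Proof.
have [[|u us] ->] := mono_gen f; first by rewrite big_nil.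
move=> _; exists u; rewrite big_cons addrAC; congr (_ + _).
apply: val_inj; apply/funext => q.
by rewrite -[LHS]/(_ q + _ q) trop_addE maxxx.
Qed.

(** This needs the balancing condition.  On the two rays spanned by [(1, 0)] and
    [(1, 2)] alone, [max(0, y - x)] is inverse to [max(- x, - y)], but its values
    [0] and [1] at these vectors are those of no monomial. *)
Lemma unit_mono f g : toIm (phi X) (f * g) = 1 ->
  exists u, toIm (phi X) f = toIm (phi X) (mono R u).
Proof.
rewrite -[1](rmorph1 (toIm (phi X))) => /toIm_phiP fg1.
have fg p : support X p -> f p * g p = 1 by move=> /fg1.
have [rho0] : exists rho : rays X, True.
  by have /fset0Pn[rho rhoX] := rays_neq0 X; exists (FSetSub rhoX).
have fg0 := fg _ (support_dir rho0) => _.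
(* Neither factor is -oo, so each has at least one monomial. *)
have [|u uf] := @mono_lower f (intmx R (dir (val rho0))).
  by move=> f0; move: fg0; rewrite f0 mul0r.
have [|v vg] := @mono_lower g (intmx R (dir (val rho0))).
  by move=> g0; move: fg0; rewrite g0 mulr0.
have le0 p : support X p -> exists y, [/\ f p = Some y,
    dot (intmx R u) p <= y & y <= - dot (intmx R v) p].
  move=> /fg; have [y -> uy] := mono_le p uf; have [z -> vz] := mono_le p vg.
  by move=> [yz]; exists y; split => //; rewrite lerNr (le_trans vz) //;
    rewrite -subr_ge0; lra.
have uvE : intmx R (u + v) = intmx R u + intmx R v by apply: map_mxD.
exists u; apply/toIm_phiP => p pX; have [y [-> uy yv]] := le0 p pX.
(* It suffices to show u + v = 0 at p, as u <= y <= - v there. *)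
suff uv : dot (intmx R (u + v)) p = 0.
  by congr Some; apply/le_anti; rewrite uy andbT; move: uv; rewrite uvE dotDl; lra.
apply: balanced_le0 pX => rho; rewrite -(ler_int R) -dot_intmx uvE dotDl.
by have [z [_ uz zv]] := le0 _ (support_dir rho); lra.
Qed.

(** The integer vector [u = (d.d) q - (d.q) d] is a multiple of the component of
    [q] orthogonal to [d].  If it is nonzero it separates; if it is zero, then
    [q] lies on the line of [d] but not on its ray, so [- d] separates, or [q]
    itself when [d = 0]. *)
Lemma ray_separation (d q : 'rV[int]_n) : ~ ray (intmx R d) (intmx R q) ->
  exists u, dot u d <= 0 /\ 0 < dot u q.
Proof.
move=> qd; pose u := dot d d *: q - dot d q *: d.
have ud : dot u d = 0 by rewrite dotBl !dotZl [dot q d]dotC mulrC subrr.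
have uu : dot u u = dot d d * dot u q.
  rewrite [in X in dot _ X]/u [LHS]dotC dotBl !dotZl ![dot _ u]dotC.
  by rewrite ud mulr0 subr0.
have [u0|u0] := eqVneq u 0; last first.
  exists u; rewrite ud; split=> //; case: (leP (dot u q) 0) => // uq.
  have uu0 : dot u u = 0.
    by apply/le_anti; rewrite dot_ge0 andbT uu mulr_ge0_le0 ?dot_ge0.
  by move: u0; rewrite (dot_eq0 uu0) eqxx.
have [d0|d0] := eqVneq d 0.
  exists q; rewrite d0 dotC dot0l; split=> //.
  rewrite lt_neqAle dot_ge0 andbT eq_sym; apply/eqP => /dot_eq0 q0.
  by apply: qd; rewrite d0 q0; exists 0; rewrite /= ?scale0r // [RHS]map_mx0.
have dd : 0 < dot d d.
  by rewrite lt_neqAle dot_ge0 andbT eq_sym; apply: contra_neq d0 => /dot_eq0.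
exists (- d); rewrite !dotNl oppr_le0 dot_ge0 oppr_gt0; split=> //.
case: ltP => // dq; case: qd; exists ((dot d q)%:~R / (dot d d)%:~R) => /=.
  by rewrite divr_ge0 ?ler0z ?dot_ge0.
apply/rowP => i; move/rowP/(_ i): u0; rewrite !mxE => /eqP.
rewrite subr_eq0 => /eqP/(congr1 (intr : int -> R)); rewrite !rmorphM /= => E.
by rewrite mulrAC -E mulrC mulKf // intr_eq0 gt_eqF.
Qed.

(** The congruence of functions agreeing on [|X|] thus determines the integral
    points of [|X|], as the points at which all its pairs agree. *)
Lemma separation (q : 'rV[int]_n) : ~ support X (intmx R q) ->
  exists f g : Bfcn R n, (forall p, support X p -> f p = g p) /\
    f (intmx R q) <> g (intmx R q).
Proof.
move=> qX; suff [f [g [fg fgq]]] : exists f g : Bfcn R n,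
    (forall rho : rays X, rho \in index_enum (rays X : finType) ->
       forall p, val rho p -> f p = g p) /\ f (intmx R q) <> g (intmx R q).
  exists f, g; split=> // p [rho rhop].
  by apply: (fg rho); rewrite ?mem_index_enum.
(* Add the rays one at a time, by twisted products. *)
elim: (index_enum _) => [|rho s [f1 [g1 [fg1 fgq1]]]]; first by exists 0, 1.
have [f2 [g2 [fg2 fgq2]]] : exists f g : Bfcn R n,
    (forall p, val rho p -> f p = g p) /\ f (intmx R q) <> g (intmx R q).
  have [_ rhoE] := dirP (rays_rational rho).
  have [|u [ud uq]] := @ray_separation (dir (val rho)) q.
    by rewrite -rhoE => qrho; apply: qX; exists rho.
  (* For u <= 0 on the ray and u > 0 at q, take max(0, u) and 0. *)
  exists (1 + mono R u), 1; split=> [p|].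
    rewrite rhoE => -[t t0 <-].
    rewrite Bfcn_addE /= trop_addE dotZr dot_intmx.
    by congr Some; apply: max_l; rewrite mulr_ge0_le0 ?lerz0.
  rewrite Bfcn_addE /= trop_addE dot_intmx => -[E].
  have : (dot u q)%:~R <= (0 : R) by rewrite -E le_max lexx orbT.
  by rewrite lerz0 leNgt uq.
exists (f1 * f2 + g1 * g2), (f1 * g2 + g1 * f2); split; last first.
  by case/trop_twisted_product.
move=> sigma; rewrite inE => /orP[/eqP->|ss] p sp.
  by rewrite !Bfcn_addE !Bfcn_mulE (fg2 _ sp).
by rewrite !Bfcn_addE !Bfcn_mulE (fg1 _ ss _ sp) addrC.
Qed.

End Fan.

(** * Homomorphisms between images of evaluation maps *)

Section FullyFaithful.
Variables (R : realType) (n m : nat).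
Variables (X : tropical_fan R n) (Y : tropical_fan R m).

(** The [j]-th coordinate of a point of [|Y|] is the value there of the monomial
    [y_j], whose pullback is recovered from [Phi_hom]. *)
Lemma Phi_hom_inj : injective (@Phi_hom R n m X Y).
Proof.
move=> mu nu mn; apply: fan_hom_ext => p; apply: val_inj; apply/rowP => j.
have [A muA] := svalP mu; have [B nuB] := svalP nu.
have [g gE] := Bfcn_comp A (mono R (delta_mx 0 j)).
have [h hE] := Bfcn_comp B (mono R (delta_mx 0 j)).
have : toIm (phi X) g = toIm (phi X) h.
  transitivity (Phi_hom mu (toIm (phi Y) (mono R (delta_mx 0 j)))).
    by symmetry; apply: Phi_homE => q; rewrite gE muA.
  by rewrite mn; apply: Phi_homE => q; rewrite hE nuB.
move=> /toIm_phiP/(_ _ (set_mem (valP p))); rewrite gE hE -muA -nuB /= => -[].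
by rewrite (_ : intmx R _ = delta_mx 0 j) ?dot_delta //; apply: map_delta_mx.
Qed.

Section Full.
Variable eta : {rmorphism Im (phi Y) -> Im (phi X)}.

(** The class of [y^u] is a unit with inverse that of [y^-u], and semiring
    homomorphisms preserve units. *)
Lemma hom_mono (u : 'rV[int]_m) : exists v : 'rV[int]_n,
  eta (toIm (phi Y) (mono R u)) = toIm (phi X) (mono R v).
Proof.
have [f fE] := Im_preim (eta (toIm (phi Y) (mono R u))).
have [g gE] := Im_preim (eta (toIm (phi Y) (mono R (- u)))).
have [|v vE] := @unit_mono _ _ X f g; last by exists v; rewrite -fE.
by rewrite rmorphM /= fE gE -!rmorphM -monoD subrr mono0 !rmorph1.
Qed.

(** The exponents [v] given by [hom_mono] are unique only up to forms vanishing
    on [|X|], so they need not depend linearly on [u]; the matrix is built from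
    choices for the coordinates alone, and the formula propagates to all [u]
    because it is stable under sums and opposites. *)
Lemma hom_mono_matrix : exists A : 'M[int]_(n, m), forall u : 'rV[int]_m,
  eta (toIm (phi Y) (mono R u)) = toIm (phi X) (mono R (u *m A^T)).
Proof.
have [a aE] := choice (fun j : 'I_m => hom_mono (delta_mx 0 j)).
pose A := (\matrix_j a j)^T; exists A.
pose P u := eta (toIm (phi Y) (mono R u)) = toIm (phi X) (mono R (u *m A^T)).
have P0 : P 0 by rewrite /P mul0mx !mono0 !rmorph1.
have PD u v : P u -> P v -> P (u + v).
  by rewrite /P mulmxDl !monoD !rmorphM => -> ->.
(* Inverses in a commutative monoid are unique. *)
have PN u : P u -> P (- u).
  rewrite /P => Pu; rewrite -[LHS]mul1r.
  rewrite -(rmorph1 (toIm (phi X))) -mono0 -[in mono R 0](mul0mx _ A^T).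
  rewrite -(addNr u) mulmxDl monoD rmorphM /= -Pu -mulrA -!rmorphM -monoD.
  by rewrite subrr mono0 !rmorph1 mulr1.
have PZ (k : int) u : P u -> P (k *: u).
  move=> Pu; have Pn (l : nat) : P (u *+ l).
    by elim: l => // l Pl; rewrite mulrS; apply: PD.
  rewrite -[k]intz scaler_int; case: k => l;
    rewrite ?NegzE ?mulrNz; [|apply: PN]; exact: Pn.
move=> u; rewrite [u]row_sum_delta; apply: (big_ind P) => // j _; apply: PZ.
by rewrite /P aE trmxK -rowE rowK.
Qed.

Lemma hom_pullback : exists A : 'M[int]_(n, m), forall (f : Bfcn R m) (g : Bfcn R n),
  (forall p, support X p -> g p = f (p *m intmx R A)) ->
  eta (toIm (phi Y) f) = toIm (phi X) g.
Proof.
have [A AE] := hom_mono_matrix; exists A => f g gf.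
have [us fE] := mono_gen f; rewrite {1}fE !rmorph_sum /=.
rewrite (eq_bigr _ (fun u _ => AE u)) -rmorph_sum; apply/toIm_phiP => p pX.
rewrite gf // fE !Bfcn_sumE; apply: eq_bigr => u _ /=.
by rewrite dot_mulmx_tr.
Qed.

(** A point of [|X|] is a nonnegative multiple of an integral one, so [separation]
    applies to the images of the primitive vectors. *)
Lemma Phi_hom_surj : exists mu : fan_hom X Y, Phi_hom mu = eta.
Proof.
have [A AE] := hom_pullback.
have AY p : support X p -> support Y (p *m intmx R A).
  move=> /supportE[rho [t [t0 ->]]]; rewrite -scalemxAl; apply: supportZ => //.
  have dA : intmx R (dir (val rho)) *m intmx R A = intmx R (dir (val rho) *m A).
    by rewrite /intmx map_mxM.
  apply: contrapT; rewrite dA => /separation[f [g [fg]]]; apply; rewrite -dA.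
  have [f' f'E] := Bfcn_comp A f; have [g' g'E] := Bfcn_comp A g.
  rewrite -f'E -g'E; apply: (toIm_phiP X f' g').1 (support_dir rho).
  rewrite -(AE f) // -(AE g) //; congr (eta _); exact/toIm_phiP.
pose mu (p : support X) : support Y :=
  exist _ (val p *m intmx R A) (mem_set (AY _ (set_mem (valP p)))).
have muA : exists B, forall p, val (mu p) = val p *m intmx R B by exists A.
exists (exist _ mu muA); apply: rmorphism_ext => y; have [f <-] := Im_preim y.
have [g gE] := Bfcn_comp A f; rewrite (AE f g) //.
by apply: Phi_homE => p; rewrite gE.
Qed.

End Full.
End FullyFaithful.

Theorem corollary3p8 (R : realType) : fully_faithful (Phi R).
Proof.
move=> [n X] [m Y] /=.
have [inv invK] := choice (@Phi_hom_surj R n m X Y).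
by exists inv => // mu; apply: Phi_hom_inj.
Qed.
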